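(* Let $p$ be a prime, let $d\ge 2$ and let $H_d$ be the free pro-$p$ group of rank $d$, with normalised Haar measure $\mu$. Let $\mathcal E(p)$ be the family of formulae $\eta_w(x)$ given by $\exists\boldsymbol y:\ w(x,\boldsymbol y)=1$, where $w$ runs over the set of $(p,d)$-zero-one words. Then $\mathrm{Spec}_\mu(\mathcal E(p),H_d)=\{0,1\}$.
   Context: A word in $k+1$ variables is an element $w(x,\boldsymbol y)$ of the free group on $x,y_1,\dots,y_k$, where $\boldsymbol y=(y_1,\dots,y_k)$; write $\#\mathrm{var}(w)=k+1$ for its number of variables. Let $-n(w)$ be the sum of the exponents of $x$ in $w$, let $n_i$ be the sum of the exponents of $y_i$ in $w$, and let $l(w)=\gcd(n_1,\dots,n_k)$, with $l(w)=0$ if all $n_i$ are zero. Given a prime $p$ and an integer $d\ge 2$, the word $w$ is a $(p,d)$-zero-one word if it satisfies one of the following: (1) $n(w)=0$; (2) $n(w)\ne 0$ and $l(w)\mid n(w)$; (3) $n(w)\neq 0$ and $l(w)=0$; (4) $n(w)\ne 0$, $l(w)\neq 0$, $l(w)\nmid n(w)$, $p\mid\gcd(1-n(w),l(w))$ and $\#\mathrm{var}(w)\le d-1$. For a formula $\varphi(x)$ in the language of groups with one free variable and a group $G$, $G_\varphi=\{g\in G\mid\varphi(g)\text{ is true in }G\}$. For a family $\mathcal F$ of such formulae and a profinite group $G$ with normalised Haar measure $\mu$ (so $\mu(G)=1$), $\mathrm{Spec}_\mu(\mathcal F,G)=\{\mu(G_\varphi)\mid\varphi\in\mathcal F\}$.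 *)

(* Defs.v *)
From HB Require Import structures.
From mathcomp Require Import all_boot all_order all_algebra.
From mathcomp Require Import all_classical all_reals.
From mathcomp Require Import ereal topology measure.

Set Implicit Arguments.
Unset Strict Implicit.
Unset Printing Implicit Defensive.

Import Order.TTheory GRing.Theory Num.Theory.

Local Open Scope classical_set_scope.
Local Open Scope card_scope.
Local Open Scope group_scope.

(* Pointedness adds nothing to a group; it is there because the library's
   measurable types are pointed. *)
HB.mixin Record isTopGroup G of PointedTopological G & Group G := {
  mulg_continuous : continuous (fun z : G * G => z.1 * z.2);
  invg_continuous : continuous (fun x : G => x^-1)
}.

#[short(type="topGroupType")]
HB.structure Definition TopGroup :=
  {G of isTopGroup G & PointedTopological G & Group G}.

Section ProP.
Implicit Types G H P : topGroupType.

Definition profinite G :=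
  [/\ compact [set: G], hausdorff_space G & totally_disconnected [set: G]].

Definition open_normal_subgroup G (N : set G) :=
  [/\ open N, N 1, (forall x y, N x -> N y -> N (x * y^-1))
    & (forall x g, N x -> N (x ^ g))].

Definition left_cosets G (N : set G) : set (set G) :=
  range (fun g : G => [set g * x | x in N]).

Definition pro_p (p : nat) G :=
  profinite G /\
  forall N : set G, open_normal_subgroup N ->
    exists m : nat, left_cosets N #= `I_(p ^ m).

Definition free_pro_p_basis (p d : nat) H (b : 'I_d -> H) :=
  forall (P : topGroupType) (f : 'I_d -> P), pro_p p P ->
    exists! phi : H -> P,
      [/\ continuous phi, {morph phi : x y / x * y} & forall i, phi (b i) = f i].

Definition free_pro_p (p d : nat) H :=
  pro_p p H /\ exists b : 'I_d -> H, free_pro_p_basis p b.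

End ProP.

Notation borel G := (g_sigma_algebraType (@open G)).

(* Outer regularity on Borel sets; as mu is finite and G is going to be
   compact, inner regularity follows by taking complements. *)
Definition haar (R : realType) (G : topGroupType)
    (mu : probability (borel G) R) :=
  (forall (g : G) (A : set G), measurable (A : set (borel G)) ->
     mu [set g * x | x in A] = mu A) /\
  (forall A : set G, measurable (A : set (borel G)) ->
     mu A = ereal_inf [set mu U | U in [set U : set G | open U /\ A `<=` U]]).

Section Formulae.

Inductive term (n : nat) : Type :=
| TVar of 'I_n
| TOne
| TMul of term n & term n
| TInv of term n.

(* A formula n has its free variables among 0, ..., n - 1; the quantifiers of
   formula n bind the variable n of their body. *)
Inductive formula : nat -> Type :=
| FEq n : term n -> term n -> formula n
| FNot n : formula n -> formula n
| FAnd n : formula n -> formula n -> formula n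
| FOr n : formula n -> formula n -> formula n
| FImp n : formula n -> formula n -> formula n
| FForall n : formula n.+1 -> formula n
| FExists n : formula n.+1 -> formula n.

Variable G : groupType.

Fixpoint teval n (e : 'I_n -> G) (t : term n) : G :=
  match t with
  | TVar i => e i
  | TOne => 1
  | TMul t1 t2 => teval e t1 * teval e t2
  | TInv t1 => (teval e t1)^-1
  end.

Definition extend n (e : 'I_n -> G) (g : G) : 'I_n.+1 -> G :=
  fun i => oapp e g (unlift ord_max i).

Fixpoint sat n (f : formula n) : ('I_n -> G) -> Prop :=
  match f in formula n return ('I_n -> G) -> Prop with
  | FEq _ t1 t2 => fun e => teval e t1 = teval e t2
  | FNot _ f1 => fun e => ~ sat f1 e
  | FAnd _ f1 f2 => fun e => sat f1 e /\ sat f2 e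
  | FOr _ f1 f2 => fun e => sat f1 e \/ sat f2 e
  | FImp _ f1 f2 => fun e => sat f1 e -> sat f2 e
  | FForall _ f1 => fun e => forall g, sat f1 (extend e g)
  | FExists _ f1 => fun e => exists g, sat f1 (extend e g)
  end.

Definition definable_set (phi : formula 1) : set G :=
  [set g | sat phi (fun=> g)].

End Formulae.

Definition Spec (R : realType) (G : topGroupType)
    (mu : probability (borel G) R) (F : set (formula 1)) : set (\bar R) :=
  [set mu (definable_set phi) | phi in F].

Section Words.
Variable k : nat.

(* An element of the free group on k + 1 generators is a reduced sequence of
   letters: (i, false) is the i-th generator and (i, true) its inverse.
   Generator 0 is x and generator i > 0 is y_i. *)
Definition reduced (s : seq ('I_k.+1 * bool)) : bool :=
  sorted (fun a b => b != (a.1, ~~ a.2)) s.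

Definition word := {s : seq ('I_k.+1 * bool) | reduced s}.

Definition exponent_sum (w : word) (i : 'I_k.+1) : int :=
  (\sum_(a <- val w | a.1 == i) (if a.2 then - 1 else 1))%R.

Definition nw (w : word) : int := (- exponent_sum w ord0)%R.

Definition lw (w : word) : nat :=
  \big[gcdn/0%N]_(i < k) `|exponent_sum w (lift ord0 i)|%N.

Definition numvar (w : word) : nat := k.+1.

Definition zero_one_word (p d : nat) (w : word) : Prop :=
  [\/ nw w = 0%R,
      nw w <> 0%R /\ (lw w %| nw w)%Z,
      nw w <> 0%R /\ lw w = 0%N
    | [/\ nw w <> 0%R, lw w <> 0%N, ~~ (lw w %| nw w)%Z,
          (p %| gcdz (1 - nw w) (lw w))%Z & (numvar w <= d - 1)%N]].

Definition letter_term (a : 'I_k.+1 * bool) : term k.+1 :=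
  if a.2 then TInv (TVar a.1) else TVar a.1.

Definition word_term (w : word) : term k.+1 :=
  foldr (fun a t => TMul (letter_term a) t) (TOne _) (val w).

End Words.

Fixpoint exists_all (k : nat) : formula k.+1 -> formula 1 :=
  match k with
  | 0 => id
  | k'.+1 => fun f => exists_all (FExists f)
  end.

Definition eta (k : nat) (w : word k) : formula 1 :=
  exists_all (FEq (word_term w) (TOne _)).

Definition zero_one_formulae (p d : nat) : set (formula 1) :=
  [set phi | exists (k : nat) (w : word k), zero_one_word p d w /\ phi = eta w].

Lemma sat_eta (G : groupType) (k : nat) (w : word k) (g : G) :
  definable_set (eta w) g <->
  exists e : 'I_k.+1 -> G, e ord0 = g /\ teval e (word_term w) = 1.
Proof.
rewrite /definable_set/= /eta.
pose f := FEq (word_term w) (TOne _).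
suff H : sat (exists_all f) (fun=> g) <->
    exists e : 'I_k.+1 -> G, e ord0 = g /\ sat f e by exact: H.
move: f; clear w; elim: k => [|k IH] f /=.
  split=> [h|[e [e0]]]; first by exists (fun=> g).
  by suff -> : e = fun=> g by []; apply/funext => i; rewrite (ord1 i).
apply: (iff_trans (IH _)); split=> /=.
  case=> e [e0 [h fh]]; exists (extend e h); split=> //.
  rewrite /extend; suff -> : ord0 = lift ord_max (ord0 : 'I_k.+1) by rewrite liftK.
  exact/val_inj.
case=> e [e0 fe]; exists (e \o lift ord_max); split.
  by rewrite -e0 /=; congr e; exact/val_inj.
exists (e ord_max); suff -> : extend (e \o lift ord_max) (e ord_max) = e by [].
by apply/funext => i; rewrite /extend; case: unliftP => [j|] ->.
Qed.

(* Main.v *)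
Require Import Defs.
From HB Require Import structures.
From mathcomp Require Import all_boot all_order all_algebra all_fingroup.
From mathcomp Require Import cyclic.
From mathcomp Require Import all_classical all_reals.
From mathcomp Require Import finmap ereal topology measure.
From mathcomp Require Import zify.

(* If l(w) divides n(w), every x is a solution: by Bezout one can take the y_i
   to be powers of x.  Otherwise the set S of solutions is closed, and it is
   shown to be null by exhibiting finite p-groups E generated by d elements
   (hence images of H_d) in which S has an image of arbitrarily small density.

   If l(w) = 0, the cyclic groups of order p^m suffice, as x is sent to an
   element killed by n(w).

   In case (4), put r = d - 1 and q = p^m, and let E be the wreath product of
   F_p by G = (Z/q)^r; it is generated by d elements.  Let w(x,y) = 1 in E and
   let K be the subgroup of G generated by the top components of the k < r
   elements y_i.  As n(w) is prime to p, the top component of x is in K too.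
   Summation over the cosets of K of the base component is additive on the
   elements of E with top component in K; as all n_i vanish in F_p and n(w) = 1
   there, the base component of x, a function from G to F_p, has sum 0 on every
   coset of K.  Such functions have density p^(-[G : K]) <= p^(-q), and K is
   determined by one of q^(rk) matrices, so S has density at most
   q^(rk) / p^q = p^(mrk - p^m), which tends to 0 with m. *)

Set Implicit Arguments.
Unset Strict Implicit.
Unset Printing Implicit Defensive.

Import Order.TTheory GRing.Theory Num.Theory.

(** * Finite groups with the discrete topology *)

Definition discrete_group (gT : finGroupType) : Type := gT.

Section DiscreteGroup.
Variable gT : finGroupType.
Local Open Scope classical_set_scope.
Local Notation D := (discrete_group gT).

HB.instance Definition _ := FinGroup.copy D gT.
HB.instance Definition _ := isPointed.Build D (1%g : gT).
HB.instance Definition _ := hasNbhs.Build D principal_filter.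
HB.instance Definition _ := Discrete_ofNbhs.Build D erefl.

Let discrete_mulg_continuous : continuous (fun z : D * D => (z.1 * z.2)%g).
Proof.
move=> [x y] A /= /principal_filterP Axy.
exists ([set x], [set y]); first by split; exact: discrete_set1.
by move=> [a b] [/= -> ->].
Qed.

Let discrete_invg_continuous : continuous (fun x : D => (x^-1)%g).
Proof.
move=> x A /= /principal_filterP Ax.
by apply/principal_filterP.
Qed.
HB.instance Definition _ :=
  isTopGroup.Build D discrete_mulg_continuous discrete_invg_continuous.

Lemma discrete_profinite : profinite D.
Proof.
split.
- exact/finite_compact/finite_finset.
- exact: discrete_hausdorff.
- exact/zero_dimension_totally_disconnected/discrete_zero_dimension.
Qed.

End DiscreteGroup.

Lemma card_eq_finset (T : finType) (A : {set T}) :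
  ([set x | x \in A]%classic #= `I_#|A|)%card.
Proof.
have -> : [set x | x \in A]%classic = [set` [fset x in enum A]%fset]%classic.
  by apply/funext => x /=; rewrite !inE mem_enum.
apply/card_eq_fsetP; rewrite card_imfset //= undup_id ?enum_uniq //.
by rewrite -cardE.
Qed.

(** The number of left cosets of a subgroup is its index, which divides the order [p ^ m]. *)
Lemma discrete_pro_p (gT : finGroupType) (p m : nat) :
  prime p -> #|gT| = (p ^ m)%N -> pro_p p (discrete_group gT).
Proof.
move=> p_pr cardG; split; first exact: discrete_profinite.
move=> N [_ N1 NV _].
pose A : {set gT} := [set x | `[< N x >]]%SET.
have inA x : (x \in A) = `[< N x >] by rewrite inE.
have gA : group_set A.
  have AV x : x \in A -> (x^-1)%g \in A.
    by rewrite !inA -(mul1g x^-1)%g => /asboolP Nx; apply/asboolP/NV.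
  apply/group_setP; split; first by rewrite inA; apply/asboolP.
  move=> x y Ax /AV; rewrite !inA in Ax * => /asboolP Ny.
  by apply/asboolP; rewrite -(invgK y); apply: NV => //; exact/asboolP.
have [i index_eq] : {i | #|[set: gT] : Group gA|%g = (p ^ i)%N}.
  apply: p_natP; apply: pnat_dvd (dvdn_indexg _ _) _.
  by rewrite cardsT cardG pnatX pnat_id.
exists i; rewrite -index_eq -card_lcosets.
rewrite -(card_eqr (card_eq_finset _)).
(* [f] turns finite sets into classical ones; it is injective and carries [lcosets] onto
   [left_cosets N]. *)
pose f (B : {set gT}) := [set x : discrete_group gT | x \in B]%classic.
suff -> : left_cosets N =
    ([set f B | B in [set B | B \in lcosets (Group gA) [set: gT]%SET]])%classic.
  apply: inj_card_eq => B C _ _ eqBC; apply/setP => x.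
  by have := congr1 (fun X : set gT => X x) eqBC => /= /is_true_inj.
apply/seteqP; split=> [_ [g _ <-]|_ [_ /lcosetsP[g _ ->] <-]] /=.
  exists (g *: A)%g; first by apply/lcosetsP; exists g.
  apply/funext => x; apply/propext; split.
    by move=> /lcosetP[y]; rewrite inA => /asboolP Ny ->; exists y.
  by move=> [y Ny <-]; apply/lcosetP; exists y => //; rewrite inA; exact/asboolP.
exists g => //; apply/funext => x; apply/propext; split.
  by move=> [y Ny <-]; apply/lcosetP; exists y => //; rewrite inA; exact/asboolP.
by move=> /lcosetP[y]; rewrite inA => /asboolP Ny ->; exists y.
Qed.

(** * Haar measure and finite quotients *)

Section HaarPreimage.
Local Open Scope classical_set_scope.
Variables (R : realType) (G : topGroupType) (mu : probability (borel G) R).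
Hypothesis mu_haar : haar mu.

Lemma open_measurable_borel (A : set G) :
  open A -> measurable (A : set (borel G)).
Proof. by move=> oA; apply: sub_sigma_algebra. Qed.

Lemma closed_measurable_borel (A : set G) :
  closed A -> measurable (A : set (borel G)).
Proof.
move=> cA; rewrite -(setCK A); apply: measurableC.
by apply: open_measurable_borel; exact: closed_openC.
Qed.

Variables (E : finGroupType) (phi : G -> discrete_group E).
Hypotheses (phi_cont : continuous phi) (phiM : {morph phi : x y / (x * y)%g}).
Hypothesis phi_surj : forall e, exists g, phi g = e.

Lemma preimage_measurable (T : set E) :
  measurable (phi @^-1` T : set (borel G)).
Proof.
apply: open_measurable_borel.
by move/continuousP: phi_cont; apply; exact: discrete_open.
Qed.

(** The fibres of [phi] are translates of its kernel, so they share one measure [c], and the [#|E|]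
    fibres add up to 1. *)
Lemma haar_preimage_card (T : {set E}) :
  (mu (phi @^-1` [set x | x \in T]) = (#|T|%:R / #|E|%:R)%:E)%E.
Proof.
pose c : R := fine (mu (phi @^-1` [set (1%g : E)])).
have muE e : mu (phi @^-1` [set e]) = c%:E.
  have [g ge] := phi_surj e.
  have phi1 : phi 1%g = 1%g by apply: (mulgI (phi 1%g)); rewrite -phiM !mulg1.
  have -> : phi @^-1` [set e] = [set g * x | x in phi @^-1` [set (1%g : E)]]%g.
    apply/seteqP; split=> [x /= xe|_ /= [x x1 <-]]; last first.
      by rewrite phiM x1 ge mulg1.
    exists (g^-1 * x)%g; last by rewrite mulVKg.
    by apply: (mulgI (phi g)); rewrite -phiM mulVKg xe ge mulg1.
  rewrite mu_haar.1; last exact: preimage_measurable.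
  by rewrite fineK // fin_num_measure //; exact: preimage_measurable.
have muT (S : {set E}) :
    (mu (phi @^-1` [set x | x \in S]) = (#|S|%:R * c)%:E)%E.
  have -> : phi @^-1` [set x | x \in S] =
      \bigcup_(e in [set` enum S]) phi @^-1` [set e].
    apply/seteqP; split=> [x /= xS|x [e /=]].
      by exists (phi x); rewrite //= mem_enum.
    by rewrite mem_enum => eS ->.
  rewrite measure_fin_bigcup /=.
  - rewrite -fsbig_seq ?enum_uniq// big_enum/=.
    under eq_bigr do rewrite muE.
    by rewrite sumEFin sumr_const mulr_natl.
  - exact: finite_seq.
  - by move=> i j _ _ [x [/= <- <-]].
  - by move=> e _; exact: preimage_measurable.
rewrite muT; congr (_ * _)%:E.
have := muT [set: E]%SET; rewrite cardsT.
have -> : phi @^-1` [set x | x \in [set: E]%SET] = setT.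
  by apply/seteqP; split=> x //= _; rewrite inE.
rewrite probability_setT => -[c1].
by apply: (mulfI (x := #|E|%:R)); rewrite -?c1 ?divff// pnatr_eq0 -lt0n;
  apply/card_gt0P; exists 1%g.
Qed.

End HaarPreimage.

(** For every [M > 0] the measure of [S] is at most [#|T| / #|E|], hence at most [1 / M]. *)
Lemma haar_null (R : realType) (G : topGroupType)
    (mu : probability (borel G) R) (S : set G) :
  haar mu -> measurable (S : set (borel G)) ->
  (forall M : nat, exists (E : finGroupType) (phi : G -> discrete_group E)
    (T : {set E}),
    [/\ continuous phi, {morph phi : x y / (x * y)%g},
        forall e, exists g, phi g = e,
        forall x, S x -> phi x \in T & (M * #|T| <= #|E|)%N]) ->
  mu S = 0%E.
Proof.
move=> mu_haar mS small.
apply/eqP; rewrite eq_le measure_ge0 andbT.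
apply/lee_addgt0Pr => e e0; rewrite add0e.
have [M Me] : exists M : nat, (e^-1 < M%:R)%R.
  by exists (Num.bound e^-1); apply: archi_boundP; rewrite invr_ge0; exact: ltW.
have [E [phi [T [cphi phiM sphi ST MT]]]] := small M.
apply: (@le_trans _ _ (mu (phi @^-1` [set x | x \in T])%classic)).
  apply: le_measure; [exact: mem_set | apply: mem_set | by []].
  exact: (preimage_measurable cphi [set x | x \in T]%classic).
rewrite (haar_preimage_card mu_haar cphi phiM sphi) lee_fin.
have E0 : (0 < #|E|%:R :> R)%R.
  by rewrite ltr0n; apply/card_gt0P; exists 1%g.
have M0 : (0 < M%:R :> R)%R by apply: lt_trans Me; rewrite invr_gt0.
rewrite ler_pdivrMr// -(ler_pM2l M0) -natrM.
apply: (@le_trans _ _ #|E|%:R%R); first by rewrite ler_nat.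
rewrite mulrA ler_peMl ?ltW//.
by rewrite -ltr_pdivrMr ?div1r.
Qed.

(** * Evaluation of words through exponent sums *)

(* [r] is a relation, not a map, so as to cover maps that are additive only on
   a subgroup, and the exponents of the powers of an element of finite order. *)
Section WordValues.
Variables (G : groupType) (Z : zmodType) (r : G -> Z -> Prop).
Hypotheses (r1 : r 1%g 0%R)
  (rM : forall g h y z, r g y -> r h z -> r (g * h)%g (y + z)%R)
  (rV : forall g z, r g z -> r g^-1%g (- z)%R).

(** As [Z] is abelian, the letters can be collected generator by generator; the rest is induction on
    the word. *)
Lemma word_term_additive k (w : word k) (e : 'I_k.+1 -> G) (z : 'I_k.+1 -> Z) :
  (forall i, r (e i) (z i)) ->
  r (teval e (word_term w)) (\sum_i z i *~ exponent_sum w i)%R.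
Proof.
move=> rez.
have -> : (\sum_i z i *~ exponent_sum w i =
    \sum_(a <- val w) z a.1 *~ (if a.2 then - 1 else 1))%R.
  rewrite (partition_big (fun a => a.1) xpredT)//=.
  apply: eq_bigr => i _; rewrite /exponent_sum mulrz_sumr.
  by apply: eq_bigr => a /eqP ->.
rewrite /word_term; elim: (val w) => [|[i b] s IHs] /=; first by rewrite big_nil.
rewrite big_cons; apply: rM => //.
by case: b; rewrite /letter_term /= ?mulrN1z ?mulr1z//; exact: rV.
Qed.

End WordValues.

Lemma bigop_gcdn_Bezout k (n : 'I_k -> int) :
  exists a : 'I_k -> int,
    (\sum_i a i * n i = (\big[gcdn/0%N]_i `|n i|%N)%:Z)%R.
Proof.
elim: k n => [|k IHk] n; first by exists (fun=> 0%R); rewrite !big_ord0.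
have [a aE] := IHk (fun i => n (lift ord0 i)).
set m := \big[_/_]_i _ in aE.
have [u [v uvE]] := Bezoutz (n ord0) m.
exists (fun i => if unlift ord0 i is Some j then v * a j else u)%R.
rewrite !big_ord_recl unlift_none /= -/m.
under eq_bigr do rewrite liftK -mulrA.
by rewrite -mulr_sumr aE uvE.
Qed.

(** Write n(w) = c l(w) and, by Bezout, l(w) as the sum of the a_i n_i. With y_i = g^(c a_i) the
    total exponent of [g] is - n(w) + c l(w) = 0. *)
Lemma word_solvable_powers (G : groupType) k (w : word k) (g : G) :
  (lw w %| nw w)%Z -> definable_set (Defs.eta w) g.
Proof.
move=> /dvdzP[c nwE]; apply/sat_eta.
have [a aE] := bigop_gcdn_Bezout (fun i => exponent_sum w (lift ord0 i)).
pose z (i : 'I_k.+1) := if unlift ord0 i is Some j then (c * a j)%R else 1%R.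
(* [r h n] says that [h] is the integer power g^n, with [n] a difference of naturals. *)
pose r (h : G) (n : int) :=
  exists s t : nat, h = (g ^+ s * g ^- t)%g /\ n = (s%:Z - t%:Z)%R.
have r_surj n : exists h, r h n.
  case: n => n; first by exists (g ^+ n)%g, n, 0; rewrite invg1 mulg1 subr0.
  by exists (g ^- n.+1)%g, 0, n.+1; rewrite mul1g sub0r.
have /choice[e0 re0] := fun i => r_surj (z i).
have r1 : r 1%g 0%R by exists 0, 0; rewrite invg1 mulg1.
have cgg s t : commute (g ^+ s)%g (g ^- t)%g.
  by apply/commuteV/commuteX2.
have rM h1 h2 y1 y2 : r h1 y1 -> r h2 y2 -> r (h1 * h2)%g (y1 + y2)%R.
  move=> [s1 [t1 [-> ->]]] [s2 [t2 [-> ->]]].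
  exists (s1 + s2), (t1 + t2); split; last by rewrite !PoszD opprD addrACA.
  rewrite [(t1 + t2)]addnC !expgnDr invgM !mulgA; congr (_ * _)%g.
  by rewrite -!mulgA; congr (_ * _)%g; rewrite cgg.
have rV h y : r h y -> r h^-1%g (- y)%R.
  by move=> [s [t [-> ->]]]; exists t, s; rewrite invgM invgK opprB.
(* At index 0, [choice] gave some element related to 1; [e] puts [g] itself there. *)
pose e i : G := if i == ord0 then g else e0 i.
have re i : r (e i) (z i).
  rewrite /e; case: eqP => [->|//]; exists 1, 0.
  by rewrite invg1 mulg1 expg1 /z unlift_none.
exists e; split; first by rewrite /e eqxx.
have [s [t [-> /eqP]]] := word_term_additive r1 rM rV w re.
rewrite big_ord_recl /z unlift_none /=.
under eq_bigr do rewrite liftK mulrzz -mulrA.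
rewrite -mulr_sumr aE -/(lw w) -nwE /nw mulrzz mul1r subrr eq_sym subr_eq0.
by move=> /eqP[->]; rewrite mulgV.
Qed.

(** * Closedness of the solution set *)

Section ClosedSolutions.
Local Open Scope classical_set_scope.
Import ArrowAsProduct.

(** The solution set is a projection of a closed subset of the compact power of [G]; hence it is
    compact, and closed as [G] is Hausdorff. *)
Lemma definable_eta_closed (G : topGroupType) k (w : word k) :
  compact [set: G] -> hausdorff_space G ->
  closed (definable_set (Defs.eta w) : set G).
Proof.
move=> cG hG.
pose X := 'I_k.+1 -> G.
have teval_continuous (t : term k.+1) : continuous (fun e : X => teval e t).
  elim: t => [i||t IHt u IHu|t IHt] /= e.
  - exact: (@proj_continuous _ (fun=> G) i e).
  - exact: (@cst_continuous X G 1%g e).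
  - apply: (@continuous2_cvg X G G G (nbhs e) _ (fun e => teval e t)
      (fun e => teval e u) (fun x y => (x * y)%g)); [|exact: IHt|exact: IHu].
    exact: (@mulg_continuous G (_, _)).
  - exact: (@continuous_comp X G G (fun e => teval e t) (fun x => (x^-1)%g) e
      (IHt e) (@invg_continuous G _)).
pose S : set X := (fun e : X => teval e (word_term w)) @^-1` [set 1%g].
have -> : definable_set (Defs.eta w) = (fun e : X => e ord0) @` S.
  apply/funext => g; apply/propext; rewrite sat_eta.
  by split=> [[e [eg we]]|[e we eg]]; exists e.
apply: compact_closed => //.
have cX : compact [set: X].
  have := @tychonoff 'I_k.+1 (fun=> G) (fun=> setT) (fun=> cG).
  by congr compact; apply/seteqP; split.
apply: continuous_compact.
  exact/continuous_subspaceT/(@proj_continuous _ (fun=> G) ord0).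
apply: subclosed_compact cX _ => //.
apply: (continuous_closedP _).1 => //.
exact/accessible_closed_set1/hausdorff_accessible.
Qed.

End ClosedSolutions.

(** * Wreath products of finite abelian groups *)

Section Wreath.
Local Open Scope ring_scope.
Variables (A G : finZmodType).

(** A pair is a top component and a base component. The separate name keeps the semidirect law, in
    which [G] acts by [shift], apart from componentwise operations. *)
Definition wreath : Type := (G * {ffun G -> A})%type.

HB.instance Definition _ := Finite.copy wreath (G * {ffun G -> A})%type.

Definition shift (g : G) (u : {ffun G -> A}) : {ffun G -> A} :=
  [ffun a => u (a + g)].

Definition wreath_mul (x y : wreath) : wreath :=
  (x.1 + y.1, x.2 + shift x.1 y.2).
Definition wreath_one : wreath := (0, 0).
Definition wreath_inv (x : wreath) : wreath := (- x.1, - shift (- x.1) x.2).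

Let wreath_mulA : associative wreath_mul.
Proof.
move=> [g u] [h v] [k t]; congr pair; rewrite /= ?addrA//.
by apply/ffunP => a; rewrite !ffunE !addrA.
Qed.

Let wreath_mul1 : left_id wreath_one wreath_mul.
Proof.
move=> [g u]; congr pair; rewrite /= ?add0r//.
by apply/ffunP => a; rewrite !ffunE addr0.
Qed.

Let wreath_mulV : left_inverse wreath_one wreath_inv wreath_mul.
Proof.
by move=> [g u]; congr pair; rewrite /= addNr.
Qed.

HB.instance Definition _ :=
  Finite_isGroup.Build wreath wreath_mulA wreath_mul1 wreath_mulV.

Lemma card_wreath : #|{: wreath}| = (#|G| * #|A| ^ #|G|)%N.
Proof. by rewrite card_prod card_ffun. Qed.

Lemma wreathM (x y : wreath) : (x * y)%g = (x.1 + y.1, x.2 + shift x.1 y.2).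
Proof. by []. Qed.

Lemma wreathV (x : wreath) : (x^-1)%g = (- x.1, - shift (- x.1) x.2).
Proof. by []. Qed.

End Wreath.

Section WreathGeneration.
Local Open Scope ring_scope.
Variables (A G : finZmodType) (H : wreath A G -> Prop).
Hypotheses (H1 : H 1%g) (HM : forall x y, H x -> H y -> H (x * y)%g).

Variables (I : finType) (g : I -> G) (a : A).
Hypotheses (g_span : forall h, exists n : I -> nat, h = \sum_i g i *+ n i)
  (a_gen : forall b, exists n, b = a *+ n).
Hypotheses (Hg : forall i, H (g i, 0))
  (Ha : H (0, [ffun h => if h == 0 then a else 0])).

(** The elements [(g i, 0)] yield all of the top group. Conjugation by it moves the function
    supported at 0 to any other point, and these functions span the base. Natural coefficients
    suffice, so closure under products is enough. *)
Lemma wreath_generated x : H x.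
Proof.
have shift0 h : shift h 0 = 0 :> {ffun G -> A}.
  by apply/ffunP => b; rewrite !ffunE.
have Htop h : H (h, 0).
  have H_add u v : H (u, 0) -> H (v, 0) -> H (u + v, 0).
    by move=> Hu /(HM Hu); rewrite wreathM /= shift0 addr0.
  have [n ->] := g_span h.
  apply: (big_ind (fun h => H (h, 0))) => // i _.
  by elim: (n i) => [//|m IHm]; rewrite mulrS; exact: H_add.
have H_add u v : H (0, u) -> H (0, v) -> H (0, u + v).
  move=> Hu /(HM Hu); rewrite wreathM /= addr0.
  suff -> : shift 0 v = v by [].
  by apply/ffunP => b; rewrite !ffunE addr0.
have Hdelta h : H (0, [ffun b => if b == h then a else 0]).
  have := HM (HM (Htop (- h)) Ha) (Htop h).
  rewrite !wreathM /= !addr0 addNr shift0 addr0 add0r.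
  congr H; congr pair; apply/ffunP => b; rewrite !ffunE.
  by rewrite subr_eq0.
case: x => h u.
have -> : (h, u) = (((0, u) : wreath A G) * ((h, 0) : wreath A G))%g :> wreath A G.
  by rewrite wreathM /= add0r shift0 addr0.
apply: HM => //.
have -> : u = \sum_h [ffun b => if b == h then u h else 0].
  apply/ffunP => b; rewrite sum_ffunE (bigD1 b)//= big1 ?addr0 ?ffunE ?eqxx//.
  by move=> c cb; rewrite ffunE eq_sym (negPf cb).
apply: (big_ind (fun u => H (0, u))) => // c _.
have [n ->] := a_gen (u c).
have -> : [ffun b => if b == c then a *+ n else 0] =
    [ffun b => if b == c then a else 0] *+ n.
  apply/ffunP => b; rewrite ffunMnE !ffunE.
  by case: eqP => // _; rewrite mul0rn.
elim: n => [//|n IHn]; rewrite mulrS; exact: H_add.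
Qed.

End WreathGeneration.

(** * Functions with zero sum on every coset of a subgroup *)

Section CosetSums.
Local Open Scope ring_scope.
Variables (A G : finZmodType) (K : {group G}).

(** The sum over a coset is recorded at each of its points, so no quotient of [G] is needed. *)
Definition coset_sum (u : {ffun G -> A}) : {ffun G -> A} :=
  [ffun c => \sum_(a in K) u (c + a)].

Lemma coset_sumD : {morph coset_sum : u v / u + v}.
Proof.
move=> u v; apply/ffunP => c; rewrite !ffunE -big_split/=.
by apply: eq_bigr => a _; rewrite ffunE.
Qed.

(** Translation by an element of [K] permutes each coset. *)
Lemma coset_sum_shift g u : g \in K -> coset_sum (shift g u) = coset_sum u.
Proof.
move=> gK; apply/ffunP => c; rewrite !ffunE [RHS](reindex_inj (addIr g)).
apply: eq_big => [a|a _]; last by rewrite ffunE addrA.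
exact/esym/(groupMr a gK).
Qed.

(** If the sum over a coset vanishes, the value at its point in [X] is minus the sum of its other
    values. *)
Lemma coset_sum_transversal (X : {set G}) (u v : {ffun G -> A}) :
  is_transversal X (rcosets K [set: G]) [set: G] ->
  coset_sum u = 0 -> coset_sum v = 0 ->
  (forall b, b \notin X -> u b = v b) -> u = v.
Proof.
move=> trX u0 v0 uvX; apply/ffunP => c.
have [cX|] := boolP (c \in X); last exact: uvX.
have sum0 (f : {ffun G -> A}) : coset_sum f = 0 ->
    f c = - \sum_(a in K | a != 0) f (c + a).
  move=> /ffunP/(_ c); rewrite !ffunE (bigD1 (0 : G)) ?addr0//=.
    by move=> /eqP; rewrite addr_eq0 => /eqP.
  exact: (group1 K).
rewrite sum0// [RHS]sum0//; congr (- _); apply: eq_bigr => a /andP[aK a0].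
(* [X] meets the coset of [c] only in [c], so [c + a] with [a != 0] lies outside [X]. *)
apply: uvX; apply: contra a0 => caX.
have cK : (K :* c)%g \in rcosets K [set: G] by apply/rcosetsP; exists c.
have /and3P[_ _ /forall_inP/(_ _ cK)/cards1P[b XcE]] := trX.
have : c \in X :&: (K :* c)%g by rewrite inE cX rcoset_refl.
have : c + a \in X :&: (K :* c)%g.
  by rewrite inE caX addrC (_ : a + c = (a * c)%g)// mem_rcoset mulgK.
rewrite XcE !inE => /eqP caE /eqP cE.
by apply/eqP/(addrI c); rewrite addr0; exact: etrans caE (esym cE).
Qed.

(** Erasing the values on a transversal is injective on these functions, and leaves functions
    supported on its complement. *)
Lemma card_coset_sum0 :
  (#|[set u | coset_sum u == 0%R]| * #|A| ^ #|[set: G] : K|%g <= #|A| ^ #|G|)%N.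
Proof.
have /transversalP trX := rcosets_partition (finset.subsetT K).
set X := transversal _ _ in trX.
have cardX : #|X| = #|[set: G] : K|%g by rewrite (card_transversal trX).
pose f (u : {ffun G -> A}) : {ffun G -> A} := [ffun b => if b \in X then 0 else u b].
have f_inj : {in [set u | coset_sum u == 0%R] &, injective f}.
  move=> u v; rewrite !inE => /eqP u0 /eqP v0 fuv.
  apply: (coset_sum_transversal trX) => // b bX.
  by have /ffunP/(_ b) := fuv; rewrite !ffunE (negPf bX).
have sub : f @: [set u | coset_sum u == 0%R] \subset pffun_on 0 (~: X) predT.
  apply/fintype.subsetP => _ /imsetP[u _ ->]; apply/pffun_onP; split=> //.
  apply/fintype.subsetP => b; rewrite unfold_in ffunE inE.
  by case: ifP => //; rewrite eqxx.
rewrite -(card_in_imset f_inj) -cardX -(cardsC X) expnD mulnC leq_mul2l.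
apply/orP; right; apply: leq_trans (subset_leq_card sub) _.
by rewrite card_pffun_on.
Qed.

(** The hypotheses on [w] abstract case (4): on [A] the n_i act as zero and n(w) injectively, and
    n(w) is invertible modulo the order of [G]. *)
Lemma wreath_word_coset_sum k (w : word k) (e : 'I_k.+1 -> wreath A G) :
  (forall i, (e (lift ord0 i)).1 \in K) ->
  (forall i (a : A), a *~ exponent_sum w (lift ord0 i) = 0) ->
  (forall a : A, a *~ nw w = 0 -> a = 0) ->
  coprime #|G| `|nw w| ->
  teval e (word_term w) = 1%g -> coset_sum (e ord0).2 = 0.
Proof.
move=> eK n_ann n_inj n_coprime we1.
(* The group law behind [{group G}] is the addition of [G], up to conversion. *)
have K_addr x y : x \in K -> y \in K -> x + y \in K.
  by move=> xK yK; exact: (groupM xK yK).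
have K_opp x : x \in K -> - x \in K by move=> xK; exact: (groupVr xK).
have K_mulrn x n : x \in K -> x *+ n \in K.
  by move=> xK; elim: n => [|n IHn]; rewrite ?mulrS; [exact: (group1 K)|exact: K_addr].
have K_mulrz x n : x \in K -> x *~ n \in K.
  move=> xK; case: n => n; first exact: K_mulrn.
  by rewrite NegzE mulrNz; exact/K_opp/K_mulrn.
(* Taking top components in w = 1 shows that n(w) times that of x is the sum of the n_i times those
   of the y_i, which lies in [K]. *)
have e0K : (e ord0).1 \in K.
  have := @word_term_additive (wreath A G) G (fun x g => x.1 = g) erefl
    (fun x y _ _ => fun E1 E2 => congr2 _ E1 E2) (fun x _ E => congr1 _ E)
    k w e (fun i => (e i).1) (fun=> erefl).
  rewrite we1 big_ord_recl /= => /esym/eqP; rewrite addrC addr_eq0 => /eqP.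
  rewrite -mulrNz -/(nw w) => nE.
  have : (e ord0).1 *~ nw w \in K.
    rewrite -nE; apply: (big_ind (fun x => x \in K)) => //; first exact: (group1 K).
    by move=> i _; exact: K_mulrz.
  have absK : (e ord0).1 *~ nw w \in K -> ((e ord0).1 ^+ `|nw w|)%g \in K.
    have -> : forall (x : G) n, (x ^+ n)%g = x *+ n by [].
    case: (nw w) => n //; rewrite NegzE mulrNz => /K_opp.
    by rewrite opprK.
  (* [expg_invn] is an inverse of the exponent modulo the order of [G]. *)
  move=> /absK /(groupX (expg_invn [set: G] `|nw w|)).
  by rewrite expgK ?inE ?cardsT.
(* Membership of the top component in [K] is carried along because [coset_sum_shift] requires it. *)
pose r (x : wreath A G) u := x.1 \in K /\ coset_sum x.2 = u.
have r1 : r 1%g 0.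
  split; first exact: (group1 K).
  by apply/ffunP => c; rewrite !ffunE big1 // => a _; rewrite ffunE.
have rM x y u v : r x u -> r y v -> r (x * y)%g (u + v).
  move=> [xK <-] [yK <-]; split; first exact: K_addr.
  by rewrite wreathM coset_sumD coset_sum_shift.
have coset_sumN u : coset_sum (- u) = - coset_sum u.
  by apply/ffunP => c; rewrite !ffunE -sumrN; apply: eq_bigr => a _; rewrite ffunE.
have rV x u : r x u -> r x^-1%g (- u).
  move=> [xK <-]; split; first exact: K_opp.
  by rewrite wreathV /= coset_sumN coset_sum_shift //; exact: K_opp.
have ffunMzE (u : {ffun G -> A}) n b : (u *~ n) b = u b *~ n.
  by case: n => n; rewrite ?NegzE ?mulrNz ?ffunE -!pmulrn ffunMnE.
have re i : r (e i) (coset_sum (e i).2).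
  by split=> //; have [j ->|->] := unliftP ord0 i.
have [_] := word_term_additive r1 rM rV w re.
rewrite we1 r1.2 big_ord_recl big1 ?addr0 => [|i _]; last first.
  by apply/ffunP => b; rewrite ffunMzE n_ann ffunE.
move=> e0n; apply/ffunP => b; rewrite [RHS]ffunE; apply: n_inj.
by rewrite /nw mulrNz -ffunMzE -e0n ffunE oppr0.
Qed.

End CosetSums.

(** * Finite images of a free pro-p group; the cyclic case l(w) = 0 *)

Lemma free_pro_p_extend (p d m : nat) (H : topGroupType) (b : 'I_d -> H)
    (E : finGroupType) (f : 'I_d -> E) :
  prime p -> #|E| = (p ^ m)%N -> free_pro_p_basis p b ->
  exists phi : H -> discrete_group E,
    [/\ continuous phi, {morph phi : x y / (x * y)%g} & forall i, phi (b i) = f i].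
Proof.
move=> p_pr cardE freeb.
by have [phi [? _]] := freeb (discrete_group E) f (discrete_pro_p p_pr cardE);
  exists phi.
Qed.

Section MorphValues.
Variables (H : groupType) (E : finGroupType) (phi : H -> E).
Hypothesis phiM : {morph phi : x y / (x * y)%g}.

Lemma morph_group1 : phi 1%g = 1%g.
Proof. by apply: (mulgI (phi 1%g)); rewrite -phiM !mulg1. Qed.

Lemma morph_groupV x : phi x^-1%g = (phi x)^-1%g.
Proof. by apply: (mulgI (phi x)); rewrite -phiM !mulgV morph_group1. Qed.

Lemma morph_teval n (e : 'I_n -> H) (t : term n) :
  phi (teval e t) = teval (phi \o e) t.
Proof.
elim: t => //= [|t IHt u IHu|t IHt]; first exact: morph_group1.
  by rewrite phiM IHt IHu.
by rewrite morph_groupV IHt.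
Qed.

End MorphValues.

Lemma lw_eq0 k (w : word k) i : lw w = 0 -> exponent_sum w (lift ord0 i) = 0%R.
Proof.
move=> l0; apply/eqP; rewrite -absz_eq0 -dvd0n -l0.
exact: (biggcdn_inf i).
Qed.

Lemma dvd_lw k (w : word k) i :
  (lw w %| exponent_sum w (lift ord0 i))%Z.
Proof. by rewrite dvdzE /=; exact: (biggcdn_inf i). Qed.

(** If [a * N] is a multiple of [n.+1], then [a] is determined by the quotient, which is less than
    [N]. *)
Lemma card_torsion_ord (n N : nat) :
  (0 < N)%N -> (#|[set a : 'I_n.+1 | (a *+ N)%R == 0%R]| <= N)%N.
Proof.
move=> N0; pose f (a : 'I_n.+1) : 'I_N.-1.+1 := inord (a * N %/ n.+1)%N.
have fE (a : 'I_n.+1) : f a = (a * N %/ n.+1)%N :> nat.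
  by rewrite inordK // prednK // ltn_divLR // mulnC ltn_pmul2l.
have f_inj : {in [set a : 'I_n.+1 | (a *+ N)%R == 0%R] &, injective f}.
  have dvd (a : 'I_n.+1) : (a *+ N)%R == 0%R -> (n.+1 %| a * N)%N.
    by rewrite Zp_mulrn => /eqP/(congr1 val)/= /eqP.
  move=> a c; rewrite !inE => /dvd aN /dvd cN /(congr1 (@nat_of_ord _)).
  rewrite !fE => ac.
  apply/val_inj/eqP; rewrite -(eqn_pmul2r N0) -(divnK aN) -(divnK cN) ac.
  by [].
by rewrite -(card_in_imset f_inj) (leq_trans (max_card _))// card_ord prednK.
Qed.

Lemma small_cyclic_image (p d k : nat) (H : topGroupType) (b : 'I_d.+1 -> H)
    (w : word k) (M : nat) :
  prime p -> free_pro_p_basis p b -> nw w <> 0%R -> lw w = 0 ->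
  exists (E : finGroupType) (phi : H -> discrete_group E) (T : {set E}),
    [/\ continuous phi, {morph phi : x y / (x * y)%g},
        forall e, exists g, phi g = e,
        forall x, definable_set (Defs.eta w) x -> phi x \in T
      & (M * #|T| <= #|E|)%N].
Proof.
move=> p_pr freeb nw0 l0.
pose N := `|nw w|%N; pose m := (M * N)%N; pose n := (p ^ m).-1.
have N0 : (0 < N)%N by rewrite absz_gt0; apply/eqP.
have nE : n.+1 = (p ^ m)%N by rewrite prednK // expn_gt0 prime_gt0.
have [//|phi [cphi phiM phib]] := @free_pro_p_extend p d.+1 m H b 'I_n.+1
  (fun=> inZp 1) p_pr _ freeb; first by rewrite card_ord.
exists 'I_n.+1, phi, [set a : 'I_n.+1 | (a *+ N == 0)%R]%SET; split=> //.
- move=> a; exists (b ord0 ^+ (a : nat))%g.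
  have -> s : phi (b ord0 ^+ s)%g = inZp s.
    elim: s => [|s IHs]; first by rewrite (morph_group1 phiM); exact/val_inj.
    rewrite expgS phiM IHs phib; apply/val_inj => /=.
    by rewrite modnDm.
  exact: valZpK.
- move=> x /sat_eta[e [ex we]]; rewrite inE.
  have := @word_term_additive H 'I_n.+1 (fun x z => phi x = z)
    (morph_group1 phiM) _ _ k w e (fun i => phi (e i)) (fun=> erefl).
  rewrite we (morph_group1 phiM) big_ord_recl big1 ?addr0 => [|i _]; last first.
    by rewrite lw_eq0.
  rewrite ex => /(_ _ _)/esym H0.
  have {H0} : (phi x *~ exponent_sum w ord0 = 0 :> 'I_n.+1)%R.
    apply: H0 => [g h y z <- <-|g z <-]; first exact: phiM.
    exact: (morph_groupV phiM).
  rewrite /N /nw abszN; case: (exponent_sum w ord0) => s.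
    by rewrite -pmulrn => ->.
  by rewrite NegzE mulrNz -pmulrn => /eqP; rewrite oppr_eq0.
- have mn : (m <= n.+1)%N by rewrite nE ltnW // ltn_expl // prime_gt1.
  rewrite card_ord; apply: leq_trans mn.
  by rewrite leq_mul2l card_torsion_ord ?orbT.
Qed.

(** * Counting in the wreath product for case (4) *)

Lemma exp_beats_linear (p c M : nat) : (1 < p)%N ->
  exists2 m : nat, (0 < m)%N & (M * (p ^ m) ^ c <= p ^ (p ^ m))%N.
Proof.
move=> p1; pose t := (2 * c + M).+1.
(* As M < p^M, it suffices that M + 2tc <= p^(2t). The right side is the square of p^t > t, hence at
   least (t + 1)^2, and [t] exceeds 2c + M. *)
exists (2 * t)%N; first by [].
apply: (@leq_trans (p ^ (M + 2 * t * c))).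
  by rewrite expnD -[(p ^ _) ^ c]expnM leq_mul2r (ltnW (ltn_expl M p1)) orbT.
rewrite leq_exp2l //.
apply: (@leq_trans (t.+1 ^ 2)); first by rewrite /t; nia.
by rewrite mulnC expnM leq_exp2r //; exact: ltn_expl.
Qed.

Section RowSpace.
Local Open Scope ring_scope.
Variables (R : finNzRingType) (k r : nat) (Y : 'M[R]_(k, r)).

Lemma row_combinations_group_set :
  group_set ([set c *m Y | c : 'rV[R]_k] : {set 'rV[R]_r}).
Proof.
apply/group_setP; split; first by apply/imsetP; exists 0; rewrite ?mul0mx.
move=> _ _ /imsetP[c _ ->] /imsetP[c' _ ->].
by apply/imsetP; exists (c + c'); rewrite ?mulmxDl.
Qed.

(** For [R = 'Z_q] this is the subgroup generated by the rows of [Y], to be the top components of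
    the y_i. *)
Definition row_combinations : {group 'rV[R]_r} := Group row_combinations_group_set.

Lemma row_in_combinations i : row i Y \in row_combinations.
Proof. by apply/imsetP; exists (delta_mx 0 i); rewrite // rowE. Qed.

Lemma card_row_combinations : (#|row_combinations| <= #|R| ^ k)%N.
Proof. by rewrite (leq_trans (leq_imset_card _ _))// card_mx mul1n. Qed.

(** By Lagrange, since the subgroup has at most |R|^k elements and k < r. *)
Lemma index_row_combinations : (1 < #|R|)%N -> (k < r)%N ->
  (#|R| <= #|[set: 'rV[R]_r] : row_combinations|%g)%N.
Proof.
move=> R1 kr; have R0 : (0 < #|R|)%N by apply: ltnW.
have := Lagrange (finset.subsetT row_combinations).
rewrite cardsT card_mx mul1n => cardE.
rewrite -(leq_pmul2l (m := #|row_combinations|)); last exact: cardG_gt0.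
rewrite cardE; apply: leq_trans (_ : #|R| ^ k * #|R| <= _)%N.
  by rewrite leq_mul2r card_row_combinations orbT.
by rewrite -expnSr leq_pexp2l.
Qed.

End RowSpace.

Section Exceptional.
Variables (A : finZmodType) (R : finNzRingType) (k r : nat).
Local Open Scope ring_scope.

(** The matrix is quantified because the subgroup varies with the solution. *)
Definition exceptional_set : {set wreath A 'rV[R]_r} :=
  [set x : wreath A 'rV[R]_r |
    [exists Y : 'M[R]_(k, r), coset_sum (row_combinations Y) x.2 == 0]].

(** A union bound over the |R|^(kr) matrices; by the index bound each contributes density at most
    |A|^(-|R|). *)
Lemma card_exceptional_set : (1 < #|R|)%N -> (k < r)%N ->
  (#|exceptional_set| * #|A| ^ #|R| <=
     (#|R| ^ r) ^ k * #|{: wreath A 'rV[R]_r}|)%N.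
Proof.
move=> R1 kr; have A0 : (0 < #|A|)%N by apply/card_gt0P; exists 0.
pose S (Y : 'M[R]_(k, r)) : {set {ffun 'rV[R]_r -> A}} :=
  [set u | coset_sum (row_combinations Y) u == 0].
have sub : exceptional_set \subset
    \bigcup_(Y : 'M[R]_(k, r)) finset.setX [set: 'rV[R]_r] (S Y).
  apply/fintype.subsetP => -[g u]; rewrite inE => /existsP[Y uY].
  by apply/finset.bigcupP; exists Y; rewrite // !inE.
have card_S Y : (#|finset.setX [set: 'rV[R]_r] (S Y)| * #|A| ^ #|R| <=
    #|{: wreath A 'rV[R]_r}|)%N.
  rewrite cardsX cardsT card_wreath -mulnA leq_mul2l; apply/orP; right.
  apply: leq_trans (card_coset_sum0 A (row_combinations Y)).
  by rewrite leq_mul2l leq_pexp2l ?orbT // index_row_combinations.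
apply: (@leq_trans
    ((\sum_(Y : 'M[R]_(k, r)) #|finset.setX [set: 'rV[R]_r] (S Y)|) * #|A| ^ #|R|)%N).
  rewrite leq_mul2r; apply/orP; right.
  apply: leq_trans (subset_leq_card sub) _.
  elim/big_ind2: _ => [|m X n Z Xm Zn|//]; first by rewrite cards0.
  by rewrite (leq_trans (leq_card_setU _ _).1)// leq_add.
rewrite big_distrl/=.
apply: (@leq_trans (\sum_(Y : 'M[R]_(k, r)) #|{: wreath A 'rV[R]_r}|)%N).
  by apply: leq_sum => Y _; exact: card_S.
by rewrite sum_nat_const card_mx -expnM [(k * r)%N]mulnC.
Qed.

End Exceptional.

Lemma mulrz_Fp_eq0 p (a : 'F_p) (n : int) :
  prime p -> (p %| n)%Z -> (a *~ n = 0)%R.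
Proof.
move=> p_pr /dvdzP[c ->]; rewrite mulrzA -pmulrn.
by rewrite -mulr_natr pchar_Fp_0 ?mulr0.
Qed.

Lemma small_wreath_image (p d k : nat) (H : topGroupType) (b : 'I_d -> H)
    (w : word k) (M : nat) :
  prime p -> free_pro_p_basis p b ->
  (p %| gcdz (1 - nw w) (lw w))%Z -> (k.+1 < d)%N ->
  exists (E : finGroupType) (phi : H -> discrete_group E) (T : {set E}),
    [/\ continuous phi, {morph phi : x y / (x * y)%g},
        forall e, exists g, phi g = e,
        forall x, definable_set (Defs.eta w) x -> phi x \in T
      & (M * #|T| <= #|E|)%N].
Proof.
(* One generator is kept for the base and [r] for the top. *)
case: d b => // r b p_pr freeb.
rewrite dvdz_gcd => /andP[p_nw p_l] kr.
have [m m0 mM] := exp_beats_linear (r * k) M (prime_gt1 p_pr).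
set q := (p ^ m)%N in mM *.
have q1 : (1 < q)%N by rewrite -(expn0 p) ltn_exp2l ?prime_gt1.
pose A : finZmodType := 'F_p; pose G : finZmodType := 'rV['Z_q]_r.
pose E : finGroupType := wreath A G.
have card_Zq : #|'Z_q| = q by rewrite card_ord Zp_cast.
have cardA : #|A| = p by rewrite card_Fp.
have cardG : #|G| = (q ^ r)%N by rewrite card_mx mul1n card_Zq.
have cardE : #|E| = (p ^ (m * r + q ^ r))%N.
  by rewrite card_wreath cardA cardG /q -expnM -expnD.
pose delta : {ffun G -> A} := [ffun h => if h == 0%R then 1%R else 0%R].
pose f (i : 'I_r.+1) : E :=
  if unlift ord0 i is Some j then (delta_mx 0%R j, 0%R) else (0%R, delta).
have [phi [cphi phiM phib]] := free_pro_p_extend f p_pr cardE freeb.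
exists E, phi, (exceptional_set A 'Z_q k r); split=> //.
- apply: (@wreath_generated A G (fun e => exists g, phi g = e) _ _
    'I_r (fun j => delta_mx 0%R j) 1%R).
  + by exists 1%g; exact: (morph_group1 phiM).
  + by move=> x y [g <-] [h <-]; exists (g * h)%g; rewrite phiM.
  + move=> h; exists (fun j => h 0%R j : nat); rewrite {1}[h]row_sum_delta.
    by apply: eq_bigr => j _; rewrite -scaler_nat natr_Zp.
  + by move=> a; exists (a : nat); rewrite natr_Zp.
  + by move=> j; exists (b (lift ord0 j)); rewrite phib /f liftK.
  + by exists (b ord0); rewrite phib /f unlift_none.
- move=> x /sat_eta[e [ex we]]; rewrite inE; apply/existsP.
  exists (\matrix_i (phi (e (lift ord0 i))).1)%R; apply/eqP; rewrite -ex.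
  apply: (@wreath_word_coset_sum A G _ k w (phi \o e)).
  + move=> i /=; set Y := (\matrix_i _)%R;
    have -> : (phi (e (lift ord0 i))).1 = row i Y by rewrite rowK.
    exact: row_in_combinations.
  + move=> i a; apply: mulrz_Fp_eq0 => //.
    by apply: dvdz_trans p_l _; exact: dvd_lw.
  (* As [p] divides 1 - n(w), n(w) acts as the identity on F_p. *)
  + move=> a a0; have := mulrz_Fp_eq0 a p_pr p_nw.
    by rewrite mulrzBr a0 subr0.
  + rewrite cardG /q -expnM; apply: coprimeXl; rewrite prime_coprime //.
    apply/negP => p_dvd.
    (* If [p] divided n(w) as well as 1 - n(w), it would divide 1. *)
    have : (p %| (1 - nw w + nw w)%R)%Z by rewrite rpredD.
    by rewrite subrK dvdz1 /= => /eqP p1; move: p_pr; rewrite p1.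
  + by rewrite -(morph_teval phiM) we (morph_group1 phiM).
- have := card_exceptional_set A (R := 'Z_q) (k := k) (r := r).
  rewrite card_Zq cardA => /(_ q1 kr) cT.
  (* Multiplied by p^q, the claim follows from the bound [cT] and the choice of [m] in [mM]. *)
  rewrite -(leq_pmul2r (m := p ^ q)%N) ?expn_gt0 ?prime_gt0//.
  rewrite -mulnA; apply: leq_trans (_ : M * ((q ^ r) ^ k * #|E|) <= _)%N.
    by rewrite leq_mul2l cT orbT.
  by rewrite mulnA [leqRHS]mulnC leq_mul2r -expnM mM orbT.
Qed.

(** * The two values of the measure *)

Lemma zero_one_word_cases (R : realType) (p d k : nat) (Hd : topGroupType)
    (mu : probability (borel Hd) R) (w : word k) :
  prime p -> (2 <= d)%N -> free_pro_p p d Hd -> haar mu ->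
  zero_one_word p d w ->
  mu (definable_set (Defs.eta w)) =
    if (lw w %| nw w)%Z then 1%E else 0%E.
Proof.
move=> p_pr d2 [pro_pH [b freeb]] mu_haar zo.
(* Cases (1) and (2) have l(w) dividing n(w), as everything divides 0. As 0 divides only 0, case (3)
   belongs with case (4). *)
case: ifPn => [l_n|l_n].
  rewrite -(probability_setT mu); congr (mu _).
  by apply/seteqP; split=> // x _; exact: word_solvable_powers.
have nw0 : nw w <> 0%R by move=> nw0; move: l_n; rewrite nw0 dvdz0.
have [[cH hH _] _] := pro_pH.
apply: haar_null => //.
  apply: (@closed_measurable_borel Hd (definable_set (Defs.eta w))).
  exact: definable_eta_closed.
case: zo => [//|[_]|[_ l0] M|[_ l0 _ pl kd] M].
- by rewrite (negPf l_n).
- by case: d b freeb d2 => // d b freeb _; exact: (small_cyclic_image _ p_pr freeb).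
- apply: (small_wreath_image M p_pr freeb) => //.
  by move: kd; rewrite /numvar; lia.
Qed.

Local Open Scope classical_set_scope.

Theorem theorem1p3 (R : realType) (p d : nat) (Hd : topGroupType)
    (mu : probability (borel Hd) R) :
  prime p -> (2 <= d)%N -> free_pro_p p d Hd -> haar mu ->
  Spec mu (zero_one_formulae p d) = [set 0%E; 1%E].
Proof.
move=> p_pr d2 freeH mu_haar.
apply/seteqP; split=> [_ [_ [k [w [zo ->]]] <-]|_ [->|->]].
- rewrite (zero_one_word_cases p_pr d2 freeH mu_haar zo).
  by case: ifP => _; [right|left].
(* The value 0 is attained by the word x, with n(w) = -1 and l(w) = 0 as an empty gcd. *)
- pose w : word 0 := exist _ [:: (ord0, false)] isT.
  have nwE : nw w = (- 1)%R by rewrite /nw /exponent_sum big_mkcond big_seq1.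
  have lwE : lw w = 0%N by rewrite /lw big_ord0.
  have zo : zero_one_word p d w by apply: Or43; rewrite nwE lwE.
  exists (Defs.eta w); first by exists 0%N, w.
  by rewrite (zero_one_word_cases p_pr d2 freeH mu_haar zo) nwE lwE.
(* The value 1 is attained by the empty word. *)
- pose w : word 0 := exist _ [::] isT.
  have nwE : nw w = 0%R by rewrite /nw /exponent_sum big_nil oppr0.
  have zo : zero_one_word p d w by apply: Or41.
  exists (Defs.eta w); first by exists 0%N, w.
  by rewrite (zero_one_word_cases p_pr d2 freeH mu_haar zo) nwE dvdz0.
Qed.
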